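(* Each symmetric Ann-category is a ring-like category (in the sense of Fröhlich and Wall), with the same bifunctors $\oplus,\otimes$, their constraints, and the same left distributivity isomorphism $\mathfrak{L}$.
   Context: Write $AB$ for $A\otimes B$. An Ann-category consists of a category $\mathcal{A}$ with bifunctors $\oplus,\otimes:\mathcal{A}\times\mathcal{A}\to\mathcal{A}$ and: (i) an object $0$ and natural isomorphisms $a^+_{X,Y,Z}:X\oplus(Y\oplus Z)\to(X\oplus Y)\oplus Z$, $c^+_{X,Y}:X\oplus Y\to Y\oplus X$, $g_X:0\oplus X\to X$, $d_X:X\oplus0\to X$ making $(\mathcal{A},\oplus)$ a symmetric categorical group, i.e. a symmetric monoidal category that is a groupoid and in which every object $X$ has an object $X'$ with $X\oplus X'\cong 0$; (ii) an object $1$ and natural isomorphisms $a_{A,B,C}:A(BC)\to(AB)C$, $l_X:1X\to X$, $r_X:X1\to X$ making $(\mathcal{A},\otimes)$ a monoidal category; (iii) natural isomorphisms $\mathfrak{L}_{A,X,Y}:A(X\oplus Y)\to AX\oplus AY$ and $\mathfrak{R}_{X,Y,A}:(X\oplus Y)A\to XA\oplus YA$, such that the following hold for all objects. (Ann-1) The functors $A\otimes-$ (with $\mathfrak{L}_{A,-,-}$) and $-\otimes A$ (with $\mathfrak{R}_{-,-,A}$) are compatible with $a^+$ and $c^+$: $(\mathfrak{L}_{A,X,Y}\oplus \mathrm{id})\mathfrak{L}_{A,X\oplus Y,Z}(\mathrm{id}_A\otimes a^+_{X,Y,Z})=a^+_{AX,AY,AZ}(\mathrm{id}\oplus\mathfrak{L}_{A,Y,Z})\mathfrak{L}_{A,X,Y\oplus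 Z}$ and $c^+_{AX,AY}\mathfrak{L}_{A,X,Y}=\mathfrak{L}_{A,Y,X}(\mathrm{id}_A\otimes c^+_{X,Y})$, and likewise $(\mathfrak{R}_{X,Y,A}\oplus \mathrm{id})\mathfrak{R}_{X\oplus Y,Z,A}(a^+_{X,Y,Z}\otimes \mathrm{id}_A)=a^+_{XA,YA,ZA}(\mathrm{id}\oplus\mathfrak{R}_{Y,Z,A})\mathfrak{R}_{X,Y\oplus Z,A}$ and $c^+_{XA,YA}\mathfrak{R}_{X,Y,A}=\mathfrak{R}_{Y,X,A}(c^+_{X,Y}\otimes \mathrm{id}_A)$. (Ann-2) (1) $\mathfrak{L}_{AB,X,Y}\circ a_{A,B,X\oplus Y}=(a_{A,B,X}\oplus a_{A,B,Y})\circ\mathfrak{L}_{A,BX,BY}\circ(\mathrm{id}_A\otimes\mathfrak{L}_{B,X,Y})$; (2) $(a_{X,B,A}\oplus a_{Y,B,A})\circ\mathfrak{R}_{X,Y,BA}=\mathfrak{R}_{XB,YB,A}\circ(\mathfrak{R}_{X,Y,B}\otimes \mathrm{id}_A)\circ a_{X\oplus Y,B,A}$; (3) $\mathfrak{R}_{AX,AY,B}\circ(\mathfrak{L}_{A,X,Y}\otimes \mathrm{id}_B)\circ a_{A,X\oplus Y,B}=(a_{A,X,B}\oplus a_{A,Y,B})\circ\mathfrak{L}_{A,XB,YB}\circ(\mathrm{id}_A\otimes\mathfrak{R}_{X,Y,B})$; (4) $v\circ(\mathfrak{R}_{A,B,X}\oplus\mathfrak{R}_{A,B,Y})\circ\mathfrak{L}_{A\oplus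 B,X,Y}=(\mathfrak{L}_{A,X,Y}\oplus\mathfrak{L}_{B,X,Y})\circ\mathfrak{R}_{A,B,X\oplus Y}$, where $v=v_{U,V,Z,T}:(U\oplus V)\oplus(Z\oplus T)\to(U\oplus Z)\oplus(V\oplus T)$ is the canonical isomorphism built from $a^+,c^+,\mathrm{id}$ (interchanging $V$ and $Z$). (Ann-3) (5.1) $(l_X\oplus l_Y)\circ\mathfrak{L}_{1,X,Y}=l_{X\oplus Y}$; (5.2) $(r_X\oplus r_Y)\circ\mathfrak{R}_{X,Y,1}=r_{X\oplus Y}$. A symmetric Ann-category is an Ann-category with a natural isomorphism $c_{A,B}:AB\to BA$ such that $(\mathcal{A},\otimes,a,c,(1,l,r))$ is a symmetric monoidal category, with $c_{0,0}=\mathrm{id}$ and (6) $\mathfrak{R}_{X,Y,A}\circ c_{A,X\oplus Y}=(c_{A,X}\oplus c_{A,Y})\circ\mathfrak{L}_{A,X,Y}$. A ring-like category is a category $\mathcal{A}$ with two symmetric monoidal structures $(\oplus,a^+,c^+,(0,g,d))$ and $(\otimes,a,c,(1,l,r))$ and natural isomorphisms $\mathfrak{L}_{A,B,C}:A(B\oplus C)\to AB\oplus AC$ such that the functors $A\otimes-$ (with $\mathfrak{L}_{A,-,-}$) are compatible with $a^+$ and $c^+$ (the two identities for $\mathfrak{L}$ in (Ann-1)), (1) holds, and for all $A,B,X,Y$ the following identity of morphisms $(X\oplus Y)(A\oplus B)\to(XA\oplus XB)\oplus(YA\oplus YB)$ holds: $$(8)\quad (\mathfrak{L}_{X,A,B}\oplus\mathfrak{L}_{Y,A,B})\circ(c_{A\oplus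 B,X}\oplus c_{A\oplus B,Y})\circ\mathfrak{L}_{A\oplus B,X,Y}\circ c_{X\oplus Y,A\oplus B}$$ $$=\big((c_{A,X}\oplus c_{B,X})\oplus(c_{A,Y}\oplus c_{B,Y})\big)\circ v_{AX,AY,BX,BY}\circ(\mathfrak{L}_{A,X,Y}\oplus\mathfrak{L}_{B,X,Y})\circ(c_{X\oplus Y,A}\oplus c_{X\oplus Y,B})\circ\mathfrak{L}_{X\oplus Y,A,B}.$$ *)

(* Defs.v *)
Set Implicit Arguments.
Unset Strict Implicit.
Unset Printing Implicit Defensive.

(* Composition is written in applicative order: [g \o f] is "g after f". *)

Record category := Category {
  ob :> Type;
  hom : ob -> ob -> Type;
  idm : forall X, hom X X;
  comp : forall X Y Z, hom Y Z -> hom X Y -> hom X Z;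
  comp1m : forall X Y (f : hom X Y), comp (idm Y) f = f;
  compm1 : forall X Y (f : hom X Y), comp f (idm X) = f;
  compA : forall X Y Z T (h : hom Z T) (g : hom Y Z) (f : hom X Y),
    comp h (comp g f) = comp (comp h g) f
}.

Arguments hom {c} X Y.
Arguments idm {c} X.
Arguments comp {c X Y Z} g f.

Declare Scope cat_scope.
Open Scope cat_scope.
Notation "g \o f" := (comp g f) (at level 50, left associativity) : cat_scope.

Record iso (C : category) (X Y : C) := Iso {
  iso_hom :> hom X Y;
  iso_inv : hom Y X;
  iso_homK : iso_inv \o iso_hom = idm X;
  iso_invK : iso_hom \o iso_inv = idm Y
}.

Definition is_iso (C : category) (X Y : C) (f : hom X Y) : Prop :=
  exists g : hom Y X, g \o f = idm X /\ f \o g = idm Y.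

Record bifunctor (C : category) := Bifunctor {
  bif_ob :> C -> C -> C;
  bif_hom : forall X X' Y Y',
    hom X X' -> hom Y Y' -> hom (bif_ob X Y) (bif_ob X' Y');
  bif_id : forall X Y, bif_hom (idm X) (idm Y) = idm (bif_ob X Y);
  bif_comp : forall X X' X'' Y Y' Y''
      (f' : hom X' X'') (f : hom X X') (g' : hom Y' Y'') (g : hom Y Y'),
    bif_hom (f' \o f) (g' \o g) = bif_hom f' g' \o bif_hom f g
}.

Arguments bif_hom {C} b {X X' Y Y'} f g.

Section Monoidal.
Variables (C : category).

Section MonoidalOn.
Variable (T : bifunctor C).
Local Notation "X * Y" := (T X Y).
Local Notation "f <*> g" := (bif_hom T f g) (at level 40, left associativity).

Record monoidal_on := MonoidalOn {
  mon_unit : C;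
  mon_assoc : forall X Y Z, iso (X * (Y * Z)) ((X * Y) * Z);
  mon_lunit : forall X, iso (mon_unit * X) X;
  mon_runit : forall X, iso (X * mon_unit) X;
  mon_assoc_nat : forall X X' Y Y' Z Z'
      (f : hom X X') (g : hom Y Y') (h : hom Z Z'),
    mon_assoc X' Y' Z' \o (f <*> (g <*> h))
      = ((f <*> g) <*> h) \o mon_assoc X Y Z;
  mon_lunit_nat : forall X X' (f : hom X X'),
    mon_lunit X' \o (idm mon_unit <*> f) = f \o mon_lunit X;
  mon_runit_nat : forall X X' (f : hom X X'),
    mon_runit X' \o (f <*> idm mon_unit) = f \o mon_runit X;
  mon_pentagon : forall X Y Z W,
    mon_assoc (X * Y) Z W \o mon_assoc X Y (Z * W)
      = (mon_assoc X Y Z <*> idm W) \o mon_assoc X (Y * Z) W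
          \o (idm X <*> mon_assoc Y Z W);
  mon_triangle : forall X Y,
    (mon_runit X <*> idm Y) \o mon_assoc X mon_unit Y = idm X <*> mon_lunit Y
}.
End MonoidalOn.

Record monoidal := Monoidal {
  tensor :> bifunctor C;
  tensor_monoidal : monoidal_on tensor
}.

Definition unit_ob (M : monoidal) : C := mon_unit (tensor_monoidal M).
Definition assoc (M : monoidal) X Y Z : iso (M X (M Y Z)) (M (M X Y) Z) :=
  mon_assoc (tensor_monoidal M) X Y Z.
Definition lunit (M : monoidal) X : iso (M (unit_ob M) X) X :=
  mon_lunit (tensor_monoidal M) X.
Definition runit (M : monoidal) X : iso (M X (unit_ob M)) X :=
  mon_runit (tensor_monoidal M) X.

Section Symmetry.
Variable (M : monoidal).
Local Notation "X * Y" := (M X Y).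
Local Notation "f <*> g" := (bif_hom M f g) (at level 40, left associativity).

Record symmetry := Symmetry {
  braiding :> forall X Y, iso (X * Y) (Y * X);
  braiding_nat : forall X X' Y Y' (f : hom X X') (g : hom Y Y'),
    braiding X' Y' \o (f <*> g) = (g <*> f) \o braiding X Y;
  braiding_sym : forall X Y, braiding Y X \o braiding X Y = idm (X * Y);
  braiding_hexagon : forall X Y Z,
    assoc M Z X Y \o braiding (X * Y) Z \o assoc M X Y Z
      = (braiding X Z <*> idm Y) \o assoc M X Z Y
          \o (idm X <*> braiding Y Z)
}.
End Symmetry.

Record symMonoidal := SymMonoidal {
  sym_monoidal :> monoidal;
  sym_symmetry : symmetry sym_monoidal
}.

Definition braid (M : symMonoidal) X Y : iso (M X Y) (M Y X) :=
  sym_symmetry M X Y.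

Section Interchange.
Variable (M : symMonoidal).
Local Notation "X + Y" := (M X Y).
Local Notation "f <+> g" := (bif_hom M f g) (at level 50, left associativity).

(* (U + V) + (Z + T) -> U + (V + (Z + T)) -> U + ((V + Z) + T)
     -> U + ((Z + V) + T) -> U + (Z + (V + T)) -> (U + Z) + (V + T) *)
Definition interchange (U V Z T : C) :
    hom ((U + V) + (Z + T)) ((U + Z) + (V + T)) :=
  assoc M U Z (V + T)
    \o (idm U <+> iso_inv (assoc M Z V T))
    \o (idm U <+> (braid M V Z <+> idm T))
    \o (idm U <+> assoc M V Z T)
    \o iso_inv (assoc M U V (Z + T)).
End Interchange.

Record is_categorical_group (M : monoidal) : Prop := IsCategoricalGroup {
  catgrp_groupoid : forall (X Y : C) (f : hom X Y), is_iso f;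
  catgrp_inverse : forall X : C,
    exists X' : C, inhabited (iso (M X X') (unit_ob M))
}.

End Monoidal.

Section Distributivity.
Variables (C : category).

Section Isos.
Variables (P M : monoidal C).
Local Notation "X + Y" := (P X Y).
Local Notation "X * Y" := (M X Y).
Local Notation "f <+> g" := (bif_hom P f g) (at level 50, left associativity).
Local Notation "f <*> g" := (bif_hom M f g) (at level 40, left associativity).

Record ldistributor := LDistributor {
  ldistr :> forall A X Y, iso (A * (X + Y)) (A * X + A * Y);
  ldistr_nat : forall A A' X X' Y Y'
      (f : hom A A') (g : hom X X') (h : hom Y Y'),
    ldistr A' X' Y' \o (f <*> (g <+> h))
      = ((f <*> g) <+> (f <*> h)) \o ldistr A X Y
}.

Record rdistributor := RDistributor {
  rdistr :> forall X Y A, iso ((X + Y) * A) (X * A + Y * A);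
  rdistr_nat : forall X X' Y Y' A A'
      (g : hom X X') (h : hom Y Y') (f : hom A A'),
    rdistr X' Y' A' \o ((g <+> h) <*> f)
      = ((g <*> f) <+> (h <*> f)) \o rdistr X Y A
}.
End Isos.

Variables (P : symMonoidal C) (M : monoidal C).
Local Notation "X + Y" := (P X Y).
Local Notation "X * Y" := (M X Y).
Local Notation "f <+> g" := (bif_hom P f g) (at level 50, left associativity).
Local Notation "f <*> g" := (bif_hom M f g) (at level 40, left associativity).
Local Notation one := (unit_ob M).

Definition ldistr_compat_assoc (L : ldistributor P M) : Prop :=
  forall A X Y Z,
    (L A X Y <+> idm (A * Z)) \o L A (X + Y) Z \o (idm A <*> assoc P X Y Z)
      = assoc P (A * X) (A * Y) (A * Z)
          \o (idm (A * X) <+> L A Y Z) \o L A X (Y + Z).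

Definition ldistr_compat_braid (L : ldistributor P M) : Prop :=
  forall A X Y,
    braid P (A * X) (A * Y) \o L A X Y = L A Y X \o (idm A <*> braid P X Y).

Definition rdistr_compat_assoc (R : rdistributor P M) : Prop :=
  forall X Y Z A,
    (R X Y A <+> idm (Z * A)) \o R (X + Y) Z A \o (assoc P X Y Z <*> idm A)
      = assoc P (X * A) (Y * A) (Z * A)
          \o (idm (X * A) <+> R Y Z A) \o R X (Y + Z) A.

Definition rdistr_compat_braid (R : rdistributor P M) : Prop :=
  forall X Y A,
    braid P (X * A) (Y * A) \o R X Y A = R Y X A \o (braid P X Y <*> idm A).

Definition ldistr_mul (L : ldistributor P M) : Prop :=
  forall A B X Y,
    L (A * B) X Y \o assoc M A B (X + Y)
      = (assoc M A B X <+> assoc M A B Y)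
          \o L A (B * X) (B * Y) \o (idm A <*> L B X Y).

Definition rdistr_mul (R : rdistributor P M) : Prop :=
  forall X Y B A,
    (assoc M X B A <+> assoc M Y B A) \o R X Y (B * A)
      = R (X * B) (Y * B) A \o (R X Y B <*> idm A) \o assoc M (X + Y) B A.

Definition lrdistr_mul (L : ldistributor P M) (R : rdistributor P M) : Prop :=
  forall A X Y B,
    R (A * X) (A * Y) B \o (L A X Y <*> idm B) \o assoc M A (X + Y) B
      = (assoc M A X B <+> assoc M A Y B)
          \o L A (X * B) (Y * B) \o (idm A <*> R X Y B).

Definition lrdistr_interchange
    (L : ldistributor P M) (R : rdistributor P M) : Prop :=
  forall A B X Y,
    interchange P (A * X) (B * X) (A * Y) (B * Y)
        \o (R A B X <+> R A B Y) \o L (A + B) X Y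
      = (L A X Y <+> L B X Y) \o R A B (X + Y).

Definition ldistr_one (L : ldistributor P M) : Prop :=
  forall X Y, (lunit M X <+> lunit M Y) \o L one X Y = lunit M (X + Y).

Definition rdistr_one (R : rdistributor P M) : Prop :=
  forall X Y, (runit M X <+> runit M Y) \o R X Y one = runit M (X + Y).

End Distributivity.

Record annCategory := AnnCategory {
  ann_cat :> category;
  ann_add : symMonoidal ann_cat;
  ann_add_group : is_categorical_group ann_add;
  ann_mul : monoidal ann_cat;
  ann_L : ldistributor ann_add ann_mul;
  ann_R : rdistributor ann_add ann_mul;
  ann_L_assoc : ldistr_compat_assoc ann_L;
  ann_L_braid : ldistr_compat_braid ann_L;
  ann_R_assoc : rdistr_compat_assoc ann_R;
  ann_R_braid : rdistr_compat_braid ann_R;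
  ann_L_mul : ldistr_mul ann_L;
  ann_R_mul : rdistr_mul ann_R;
  ann_LR_mul : lrdistr_mul ann_L ann_R;
  ann_LR_interchange : lrdistr_interchange ann_L ann_R;
  ann_L_one : ldistr_one ann_L;
  ann_R_one : rdistr_one ann_R
}.

Record symAnnCategory := SymAnnCategory {
  sann_ann :> annCategory;
  sann_sym : symmetry (ann_mul sann_ann);
  sann_braid00 : let O := unit_ob (ann_add sann_ann) in
    iso_hom (sann_sym O O) = idm (ann_mul sann_ann O O);
  sann_braid_LR : forall A X Y : sann_ann,
    ann_R sann_ann X Y A \o sann_sym A (ann_add sann_ann X Y)
      = bif_hom (ann_add sann_ann) (sann_sym A X) (sann_sym A Y)
          \o ann_L sann_ann A X Y
}.

Definition sann_mul (S : symAnnCategory) : symMonoidal S :=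
  SymMonoidal (sann_sym S).

Section RingLike.
Variables (C : category) (P M : symMonoidal C) (L : ldistributor P M).
Local Notation "X + Y" := (P X Y).
Local Notation "X * Y" := (M X Y).
Local Notation "f <+> g" := (bif_hom P f g) (at level 50, left associativity).
Local Notation c := (braid M).

Definition ldistr_interchange : Prop :=
  forall A B X Y,
    (L X A B <+> L Y A B) \o (c (A + B) X <+> c (A + B) Y)
        \o L (A + B) X Y \o c (X + Y) (A + B)
      = ((c A X <+> c B X) <+> (c A Y <+> c B Y))
          \o interchange P (A * X) (A * Y) (B * X) (B * Y)
          \o (L A X Y <+> L B X Y)
          \o (c (X + Y) A <+> c (X + Y) B)
          \o L (X + Y) A B.

(* The category C with the sum P, the product M and the left distributivity L
   is a ring-like category; the symmetric monoidal laws and the naturality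
   of L are part of the types of P, M and L. *)
Record is_ring_like : Prop := IsRingLike {
  ring_like_L_assoc : ldistr_compat_assoc L;
  ring_like_L_braid : ldistr_compat_braid L;
  ring_like_L_mul : ldistr_mul L;
  ring_like_interchange : ldistr_interchange
}.
End RingLike.

(* Main.v *)
Require Import Defs.

(* By (6) and the symmetry of c, the right distributor is determined by the left
   one: R = (c + c) L c.  Substituting this in axiom (4) and moving the braidings
   across the interchange v by naturality turns (4) into (8). *)

Lemma iso_inv_nat (C : category) (X Y X' Y' : C) (i : iso X Y) (j : iso X' Y')
    (f : hom X X') (g : hom Y Y') :
  j \o f = g \o i -> iso_inv j \o g = f \o iso_inv i.
Proof.
  intro H.
  rewrite <- (compm1 (_ \o g)), <- (iso_invK i), compA.
  rewrite <- (compA (iso_inv j) g i), <- H, compA, iso_homK, comp1m.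
  reflexivity.
Qed.

(** By bifunctoriality, both sides are [bif_hom T k] of the diagonal of the given square. This
    handles the three middle factors of [interchange], which fix the first summand. *)
Lemma bif_hom_id_nat (C : category) (T : bifunctor C) (U U' X Y X' Y' : C)
    (k : hom U U') (p : hom X Y) (q : hom X' Y') (f : hom X X') (g : hom Y Y') :
  q \o f = g \o p ->
  bif_hom T (idm U') q \o bif_hom T k f = bif_hom T k g \o bif_hom T (idm U) p.
Proof. intro H; rewrite <- !bif_comp, comp1m, compm1, H; reflexivity. Qed.

Lemma interchange_nat (C : category) (P : symMonoidal C)
    (U U' V V' Z Z' T T' : C)
    (f : hom U U') (g : hom V V') (h : hom Z Z') (k : hom T T') :
  interchange P U' V' Z' T' \o bif_hom P (bif_hom P f g) (bif_hom P h k)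
    = bif_hom P (bif_hom P f h) (bif_hom P g k) \o interchange P U V Z T.
Proof.
  unfold interchange.
  (* [N1] to [N5] are the naturality squares of the five factors of [interchange], the factor
     applied first coming first. *)
  assert (N1 : iso_inv (assoc P U' V' (P Z' T'))
                 \o bif_hom P (bif_hom P f g) (bif_hom P h k)
               = bif_hom P f (bif_hom P g (bif_hom P h k))
                 \o iso_inv (assoc P U V (P Z T)))
    by apply iso_inv_nat, mon_assoc_nat.
  assert (N2 : bif_hom P (idm U') (assoc P V' Z' T')
                 \o bif_hom P f (bif_hom P g (bif_hom P h k))
               = bif_hom P f (bif_hom P (bif_hom P g h) k)
                 \o bif_hom P (idm U) (assoc P V Z T))
    by apply bif_hom_id_nat, mon_assoc_nat.
  assert (N3 : bif_hom P (idm U') (bif_hom P (braid P V' Z') (idm T'))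
                 \o bif_hom P f (bif_hom P (bif_hom P g h) k)
               = bif_hom P f (bif_hom P (bif_hom P h g) k)
                 \o bif_hom P (idm U) (bif_hom P (braid P V Z) (idm T))).
  { apply bif_hom_id_nat; rewrite <- !bif_comp, comp1m, compm1.
    f_equal; apply braiding_nat. }
  assert (N4 : bif_hom P (idm U') (iso_inv (assoc P Z' V' T'))
                 \o bif_hom P f (bif_hom P (bif_hom P h g) k)
               = bif_hom P f (bif_hom P h (bif_hom P g k))
                 \o bif_hom P (idm U) (iso_inv (assoc P Z V T)))
    by apply bif_hom_id_nat, iso_inv_nat, mon_assoc_nat.
  assert (N5 : assoc P U' Z' (P V' T')
                 \o bif_hom P f (bif_hom P h (bif_hom P g k))
               = bif_hom P (bif_hom P f h) (bif_hom P g k)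
                 \o assoc P U Z (P V T))
    by apply mon_assoc_nat.
  rewrite <- !compA, N1.
  (* The pattern [bif_hom P f _] locates the sum of the four morphisms as it moves left: the
     structural factors have an identity in place of [f]. *)
  rewrite (compA _ (bif_hom P f _)), N2, <- compA.
  rewrite (compA _ (bif_hom P f _)), N3, <- compA.
  rewrite (compA _ (bif_hom P f _)), N4, <- compA.
  rewrite (compA _ (bif_hom P f _)), N5, <- compA.
  reflexivity.
Qed.

(** [sann_braid_LR] turns the first two factors into [ann_R] after a braiding, which cancels against
    the last one. *)
Lemma rdistr_braid (S : symAnnCategory) (A X Y : S) :
  bif_hom (ann_add S) (braid (sann_mul S) A X) (braid (sann_mul S) A Y)
      \o ann_L S A X Y \o braid (sann_mul S) (ann_add S X Y) A
    = ann_R S X Y A.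
Proof.
  unfold braid; simpl.
  rewrite <- sann_braid_LR, <- compA, braiding_sym, compm1.
  reflexivity.
Qed.

Theorem proposition6p1 (S : symAnnCategory) :
  @is_ring_like (ann_cat S) (ann_add S) (sann_mul S) (ann_L S).
Proof.
  split.
  - apply ann_L_assoc.
  - apply ann_L_braid.
  - apply ann_L_mul.
  - intros A B X Y.
    rewrite <- interchange_nat.
    (* On the left, the last three factors are grouped and become [ann_R S X Y] at the sum of [A]
       and [B]. *)
    rewrite <- (compA _ _ (ann_L S (ann_add S A B) X Y)).
    rewrite <- (compA _ (_ \o ann_L S (ann_add S A B) X Y)).
    rewrite rdistr_braid.
    (* On the right, the three sums between [interchange] and [ann_L] merge into one, whose summands
       are [ann_R S X Y] at [A] and at [B]. *)
    rewrite <- (compA (interchange _ _ _ _ _)), <- bif_comp.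
    rewrite <- (compA (interchange _ _ _ _ _)), <- bif_comp.
    rewrite !rdistr_braid.
    (* This is the axiom with the pairs [A], [B] and [X], [Y] exchanged. *)
    symmetry; apply ann_LR_interchange.
Qed.
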